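(* Let $(p_{k,l})_{-1\le k,l\le 1}$ be nonnegative numbers with $\sum_{k,l}p_{k,l}=1$, and let $(X,Y)=(X(n),Y(n))_{n\ge 0}$ be a Markov chain on $\mathbb{Z}_+^2=\{0,1,2,\dots\}^2$ which, from every state $(i,j)$ with $i,j\ge 1$, jumps to $(i+k,j+l)$ with probability $p_{k,l}$. Assume: (H2) in the list $p_{1,1},p_{1,0},p_{1,-1},p_{0,-1},p_{-1,-1},p_{-1,0},p_{-1,1},p_{0,1}$ there are no three consecutive zeros; (H3) $p_{1,1}+p_{-1,1}+p_{-1,-1}+p_{1,-1}<1$; and that both drifts vanish: $\sum_{k,l} k\,p_{k,l}=0$ and $\sum_{k,l} l\,p_{k,l}=0$. Then there exists a constant $A\in(0,\infty)$ such that for every fixed $j_0\ge 1$, $$\mathbb{P}_{(i_0,j_0)}[(X,Y)\text{ hits }\mathcal{V}\text{ before }\mathcal{H}^*]\sim A\,\frac{j_0}{i_0},\qquad i_0\to\infty.$$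
   Context: $\mathbb{P}_{(i_0,j_0)}$ denotes probability for the chain started at $(i_0,j_0)$ with $i_0,j_0\ge1$. $\mathcal{H}=\{(i,0):i\ge 0\}$, $\mathcal{V}=\{(0,j):j\ge 0\}$, $\mathcal{H}^*=\mathcal{H}\setminus\{(0,0)\}$. The event ''$(X,Y)$ hits $\mathcal{V}$ before $\mathcal{H}^*$'' means that the first point of $\mathcal{H}\cup\mathcal{V}$ visited by the chain lies in $\mathcal{V}$ (the behaviour of the chain on the axes is irrelevant). *)

(* Defs.v *)
From HB Require Import structures.
From mathcomp Require Import all_boot all_order all_algebra.
From mathcomp Require Import all_classical all_reals all_analysis.
Set Implicit Arguments. Unset Strict Implicit. Unset Printing Implicit Defensive.
Import Order.TTheory GRing.Theory Num.Theory.
Import numFieldNormedType.Exports.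
Local Open Scope ring_scope.

Definition dirs : seq int := [:: -1; 0; 1].

(* hitN p N x y : probability that the walk with interior transition
   probabilities p k l (jump (x,y) -> (x+k,y+l)), started at (x,y),
   reaches H ∪ V within N steps and the first such point lies in V.
   On V (x = 0, including the origin) the value is 1; on H* it is 0. *)
Fixpoint hitN (R : realType) (p : int -> int -> R) (N : nat) (x y : int) : R :=
  if x == 0 then 1
  else if y == 0 then 0
  else match N with
       | 0%N => 0
       | N'.+1 => \sum_(k <- dirs) \sum_(l <- dirs) p k l * hitN p N' (x + k) (y + l)
       end.

(* P_{(x,y)}[(X,Y) hits V before H*] = lim_N P[... within N steps]
   (monotone limit of the finite-horizon probabilities). *)
Definition hitP (R : realType) (p : int -> int -> R) (x y : int) : R :=
  limn (fun N => hitN p N x y).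

Definition plist (R : realType) (p : int -> int -> R) : seq R :=
  [:: p 1 1; p 1 0; p 1 (-1); p 0 (-1); p (-1) (-1); p (-1) 0; p (-1) 1; p 0 1].

Definition H2 (R : realType) (p : int -> int -> R) : Prop :=
  forall i : nat, (i < 8)%N ->
    ~ [/\ nth 0 (plist p) i = 0,
          nth 0 (plist p) ((i + 1) %% 8) = 0
        & nth 0 (plist p) ((i + 2) %% 8) = 0].

(* Main.v *)
Require Import Defs.
From HB Require Import structures.
From mathcomp Require Import all_boot all_order all_algebra.
From mathcomp Require Import all_classical all_reals all_analysis.
From mathcomp Require Import ring lra zify.
Import Order.TTheory GRing.Theory Num.Theory.
Import numFieldNormedType.Exports.
Local Open Scope classical_set_scope.
Local Open Scope ring_scope.

Set Implicit Arguments.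
Unset Strict Implicit.
Unset Printing Implicit Defensive.

(**
The zero drift makes the angular variable of the limiting Brownian motion almost
harmonic for the walk.  With s^2 = E[l^2], t^2 = E[k^2], the coordinates
P = al (s x + t y), Q = be (t y - s x), where al^2 + be^2 = 1 and
s t (be^2 - al^2) = E[k l], have uncorrelated increments of equal variance, and the
quadrant becomes the cone |Q| <= (be / al) P.  The angle u of (P, Q), normalised to be 0
on H and 1 on V, is harmonic up to an error O(r^-3), where r^2 = P^2 + Q^2.  This error is
absorbed by the barrier w = (cos theta / al - 1) / r, with theta the angle from the axis
of the cone: it is nonnegative, vanishes on the axes, and E[w] drops by at least a constant
times r^-3 per step far from the origin.  Hence |h - u| <= K w for the hitting probability
h, and for fixed y one has w = O(x^-2) while u ~ A y / x.
*)

(** * Elementary inequalities, then expansions for one step from a unit vector *)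

Lemma normrM_le (R : realFieldType) (x y a b : R) :
  `|x| <= a -> `|y| <= b -> `|x * y| <= a * b.
Proof. by move=> xa yb; rewrite normrM ler_pM. Qed.

(** By the mean value theorem [atan t = t / (1 + c ^+ 2)] with [c] between 0 and [t]; oddness covers
    negative [t]. *)
Lemma atan_cubic (R : realType) (t : R) : `|atan t - t| <= `|t| ^+ 3.
Proof.
suff pos (x : R) : 0 <= x -> `|atan x - x| <= `|x| ^+ 3.
  have [/pos//|t0] := leP 0 t.
  have := pos (- t); rewrite oppr_ge0 => /(_ (ltW t0)).
  by rewrite atanN -opprD !normrN.
move=> {t} x0.
have [c] : exists2 c, c \in `[0, x]%R & atan x - atan 0 = (1 + c ^+ 2)^-1 * (x - 0).
  apply: (@MVT_segment R atan (fun y => (1 + y ^+ 2)^-1)) => //.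
  by apply: continuous_subspaceT => y; exact: continuous_atan.
rewrite in_itv/= atan0 !subr0 => /andP[c0 cx] ->.
have c2 : 0 < 1 + c ^+ 2 by rewrite ltr_pwDl ?sqr_ge0.
rewrite (_ : _ - x = - (x * c ^+ 2 / (1 + c ^+ 2))); last by field; rewrite gt_eqF.
rewrite normrN !ger0_norm// ?mulr_ge0 ?invr_ge0 ?sqr_ge0 ?(ltW c2)//.
rewrite ler_pdivrMr// exprS -mulrA ler_wpM2l//.
apply: (@le_trans _ _ (x ^+ 2)); first by rewrite ler_sqr ?nnegrE.
by rewrite ler_peMr ?sqr_ge0// lerDl sqr_ge0.
Qed.

(** The hypothesis makes the cosine of the difference positive. This places the difference between
    -pi/2 and pi/2, where it is recovered from its tangent. *)
Lemma atanB (R : realType) (a b : R) : 0 < 1 + a * b ->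
  atan a - atan b = atan ((a - b) / (1 + a * b)).
Proof.
move=> ab.
have ha := atan_def a; have hb := atan_def b.
have ca : 0 < cos (atan a) by apply: cos_gt0_pihalf; case: ha.
have cb : 0 < cos (atan b) by apply: cos_gt0_pihalf; case: hb.
have tE x : tan x = sin x / cos x :> R by [].
have sa : sin (atan a) = a * cos (atan a) by rewrite -{2}(atanK a) tE divfK ?gt_eqF.
have sb : sin (atan b) = b * cos (atan b) by rewrite -{2}(atanK b) tE divfK ?gt_eqF.
have cab : 0 < cos (atan a - atan b).
  rewrite cosB sa sb.
  rewrite (_ : _ + _ = cos (atan a) * cos (atan b) * (1 + a * b)); last by ring.
  by rewrite !mulr_gt0.
have main x : 0 <= x -> x < pi -> 0 < cos x -> x < pi / 2 :> R.
  move=> x0 xpi; rewrite -(@cos_pihalf R) ltr_cos ?in_itv/= ?x0 ?(ltW xpi)//.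
  by have := @pi_gt0 R; move: pi => q q0; apply/andP; split; lra.
have bnd : atan a - atan b \in `](- (pi / 2)), (pi / 2)[.
  case: ha => /andP[a1 a2] _; case: hb => /andP[b1 b2] _.
  rewrite in_itv/=; have [h|/ltW h] := leP 0 (atan a - atan b).
    have := main _ h _ cab; have := @pi_gt0 R.
    move: pi a1 a2 b1 b2 h => q a1 a2 b1 b2 h q0 hh.
    by apply/andP; split; [lra|apply: hh; lra].
  have h' : 0 <= - (atan a - atan b) by rewrite oppr_ge0.
  have := main _ h' _; rewrite cosN => /(_ _ cab); have := @pi_gt0 R.
  move: pi a1 a2 b1 b2 h h' => q a1 a2 b1 b2 h h' q0 hh.
  by apply/andP; split; [have := hh ltac:(lra); lra|lra].
rewrite -[LHS]tanK//; congr atan.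
rewrite tanD ?cosN ?gt_eqF// tanN !atanK; congr (_ / _); ring.
Qed.

Lemma le_invsqrt (R : rcfType) (x z : R) : 0 < z -> x ^+ 2 * z <= 1 ->
  x <= (Num.sqrt z)^-1.
Proof.
move=> z0 xz; have s0 : 0 < Num.sqrt z by rewrite sqrtr_gt0.
have [x0|x0] := leP x 0; first by rewrite (le_trans x0)// invr_ge0 ltW.
rewrite -[leRHS]mul1r ler_pdivlMr// -ler_sqr ?nnegrE ?mulr_ge0 ?(ltW x0) ?(ltW s0)//.
by rewrite expr1n exprMn sqr_sqrtr ?(ltW z0).
Qed.

(* A step (p, q) of size at most e from the unit vector (C, S): X and Y are its tangential
   and radial parts, and |(C + p, S + q)|^2 = 1 + 2 Y + D. *)
Section unit_steps.
Variable R : realType.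
Variables (C S p q e : R).
Hypothesis CS : C ^+ 2 + S ^+ 2 = 1.
Hypotheses (pe : `|p| <= e) (qe : `|q| <= e) (e16 : 16 * e <= 1).
Let X := C * q - S * p.
Let Y := C * p + S * q.
Let D := p ^+ 2 + q ^+ 2.

Let e0 : 0 <= e. Proof. by apply: le_trans pe. Qed.

Let C1 : `|C| <= 1.
Proof. by rewrite -(@ler_sqr R) ?nnegrE// -normrX ger0_norm ?sqr_ge0// expr1n -CS lerDl sqr_ge0. Qed.

Let S1 : `|S| <= 1.
Proof. by rewrite -(@ler_sqr R) ?nnegrE// -normrX ger0_norm ?sqr_ge0// expr1n -CS lerDr sqr_ge0. Qed.

Let X2 : `|X| <= 2 * e.
Proof.
apply: (le_trans (ler_normB _ _)).
by have := normrM_le C1 qe; have := normrM_le S1 pe; lra.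
Qed.

Let Y2 : `|Y| <= 2 * e.
Proof.
apply: (le_trans (ler_normD _ _)).
by have := normrM_le C1 pe; have := normrM_le S1 qe; lra.
Qed.

Let D2 : `|D| <= 2 * e ^+ 2.
Proof.
apply: (le_trans (ler_normD _ _)).
have := normrM_le pe pe; have := normrM_le qe qe; rewrite -!expr2; lra.
Qed.

Let E5 : `|2 * Y + D| <= 5 * e.
Proof.
have e0' := e0; have e16' := e16.
apply: (le_trans (ler_normD _ _)); rewrite normrM (ger0_norm (ler0n _ 2)).
have : 2 * e ^+ 2 <= e.
  rewrite expr2 mulrA ler_piMl//.
 lra.
by move: D2 Y2; lra.
Qed.

Let Y8 : 7 / 8 <= 1 + Y.
Proof. have e16' := e16. by move: Y2; rewrite ler_norml; lra. Qed.

(* The angle turns by atan (X / (1 + Y)). *)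
Lemma atan_step : 0 < C -> 0 < C + p ->
  `|atan ((S + q) / (C + p)) - atan (S / C) - X + X * Y| <= 30 * e ^+ 3.
Proof.
have e0' := e0; have e16' := e16.
move=> C0 Cp0.
(* The numerator is [C * (C + p) + S * (S + q) = 1 + Y]. *)
have H : 1 + (S + q) / (C + p) * (S / C) = (1 + Y) / ((C + p) * C).
  rewrite /Y -[in RHS]CS; field; rewrite !gt_eqF//.
have Y8' := Y8; have Y0 : 0 < 1 + Y by lra.
rewrite atanB; last by rewrite H divr_gt0// mulr_gt0.
rewrite (_ : _ / _ = X / (1 + Y)); last first.
  rewrite H /X; field; by rewrite !gt_eqF.
set t := X / (1 + Y).
have t1 : `|t| <= 16 / 7 * e.
  rewrite /t normrM normfV (ger0_norm (ltW Y0)) ler_pdivrMr//.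
  apply: (le_trans X2).
  rewrite -subr_ge0 (_ : _ - _ = 16 / 7 * (e * (1 + Y - 7 / 8))); last by field.
  by rewrite !mulr_ge0//; lra.
have t3 : `|t| ^+ 3 <= (16 / 7 * e) ^+ 3 by rewrite lerXn2r ?nnegrE// mulr_ge0//; lra.
(* Since [X = t * (1 + Y)], the part [t - X + X * Y] collapses to [t * Y ^+ 2], which is of third
   order. *)
rewrite (_ : _ + _ = (atan t - t) + t * Y ^+ 2); last first.
  by rewrite /t; field; rewrite gt_eqF.
apply: (le_trans (ler_normD _ _)).
apply: (le_trans (lerD (atan_cubic t) (normrM_le t1 (normrM_le Y2 Y2)))).
apply: (le_trans (lerD t3 (lexx _))).
rewrite -subr_ge0.
rewrite (_ : _ - _ = (30 - (16 / 7) ^+ 3 - 16 / 7 * 4) * e ^+ 3); last by ring.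
by rewrite mulr_ge0 ?exprn_ge0//; lra.
Qed.

(** The quotient is the Kelvin transform of the first coordinate, evaluated after the step. With E =
    2 Y + D one has 1/(1+E) = 1 - E + E^2 - E^3/(1+E), and the subtracted polynomial collects the
    terms of order at most two in the step. *)
Lemma kelvin_step :
  `|(C + p) / (1 + (2 * Y + D)) - C
    - (p - 2 * C * Y - C * D - 2 * Y * p + 4 * C * Y ^+ 2)| <= 600 * e ^+ 3.
Proof.
have e0' := e0; have e16' := e16.
set E := 2 * Y + D.
have Eh : 2^-1 <= 1 + E by move: E5; rewrite -/E ler_norml; lra.
have E0 : 0 < 1 + E by lra.
rewrite (_ : _ - _ = - (p * D) + p * (E * E) + C * (4 * Y * D + D * D)
   - (C + p) * (E * (E * E)) / (1 + E)); last first.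
  by rewrite /E; field; rewrite gt_eqF.
have e2 : `|e| <= e by rewrite ger0_norm.
have b1 := normrM_le pe D2.
have b2 := normrM_le pe (normrM_le E5 E5).
have b3 : `|4 * Y * D + D * D| <= 4 * (2 * e) * (2 * e ^+ 2) + (2 * e ^+ 2) * (2 * e ^+ 2).
  apply: (le_trans (ler_normD _ _)); apply: lerD; apply: normrM_le => //.
  by apply: normrM_le => //; rewrite ger0_norm.
have b4 := normrM_le C1 b3.
have b5 : `|(C + p) * (E * (E * E)) / (1 + E)| <= 2 * ((5 * e) * ((5 * e) * (5 * e))) * 2.
  apply: normrM_le; last by rewrite normfV ger0_norm ?(ltW E0)// invf_ple// posrE.
  apply: normrM_le; last by rewrite !normrM_le.
  by apply: (le_trans (ler_normD _ _)); move: pe C1; lra.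
(* The remainders contribute 2, 25, 16 + 4 and 500 times [e ^+ 3], hence the constant 600. *)
apply: (le_trans (ler_normB _ _)); apply: (le_trans (lerD (ler_normD _ _) b5)).
have := ler_normD (- (p * D)) (p * (E * E)); rewrite normrN => b6.
have e34 : e ^+ 4 <= e ^+ 3 by rewrite exprS ler_piMl ?exprn_ge0//; lra.
have e30 : 0 <= e ^+ 3 by rewrite exprn_ge0.
have -> : 2 * (5 * e * (5 * e * (5 * e))) * 2 = 500 * e ^+ 3 by ring.
move: b1 b2 b4 b6.
have -> : e * (2 * e ^+ 2) = 2 * e ^+ 3 by ring.
have -> : e * (5 * e * (5 * e)) = 25 * e ^+ 3 by ring.
have -> : 1 * (4 * (2 * e) * (2 * e ^+ 2) + 2 * e ^+ 2 * (2 * e ^+ 2))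
  = 16 * e ^+ 3 + 4 * e ^+ 4 by ring.
lra.
Qed.

(** A lower bound suffices: the inverse radius enters the barrier [bar] with a minus sign, and [bar]
    is only estimated from above after a step. *)
Lemma invsqrt_step :
  1 - Y - D / 2 + 3 / 2 * Y ^+ 2 - 200 * e ^+ 3 <= (Num.sqrt (1 + (2 * Y + D)))^-1.
Proof.
have e0' := e0; have e16' := e16.
set E := 2 * Y + D.
have Eh : 2^-1 <= 1 + E by move: E5; rewrite -/E ler_norml; lra.
have E0 : 0 < 1 + E by lra.
have s0 : 0 < Num.sqrt (1 + E) by rewrite sqrtr_gt0.
set g := `|E| ^+ 3; set P := 1 - E / 2 + 3 / 8 * E ^+ 2.
have Ea : `|E| <= 5 / 16 by apply: (le_trans E5); lra.
have g0 : 0 <= g by rewrite exprn_ge0.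
have g1 : g <= (5 / 16) ^+ 3 by rewrite lerXn2r ?nnegrE.
have Eg : E ^+ 3 <= g by rewrite /g -normrX ler_norm.
have [El Eu] : - (5 / 16) <= E /\ E <= 5 / 16 by move: Ea; rewrite ler_norml => /andP.
have P0 : 3 / 4 <= P by rewrite /P; have := sqr_ge0 E; lra.
(* P is the second-order Taylor polynomial of (1 + E)^-1/2. *)
have v1 : P - g <= (Num.sqrt (1 + E))^-1.
  apply: le_invsqrt => //.
  (* The leading error [5 / 8 * E ^+ 3] is paid by the last term, because [(2 * P - g) * (1 + E)] is
     at least 5/8. *)
  have -> : (P - g) ^+ 2 * (1 + E) = 1 + 5 / 8 * E ^+ 3 - E ^+ 4 * (15 / 64 - 9 / 64 * E)
     - g * ((2 * P - g) * (1 + E)) by rewrite /P; field.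
  have h1 : 0 <= E ^+ 4 * (15 / 64 - 9 / 64 * E).
    by rewrite mulr_ge0 ?exprn_even_ge0//; lra.
  have h2 : g * (5 / 8) <= g * ((2 * P - g) * (1 + E)).
    by rewrite ler_wpM2l//; nra.
  lra.
apply: le_trans v1; rewrite /P.
have g5 : g <= 125 * e ^+ 3.
  rewrite (_ : 125 * e ^+ 3 = (5 * e) ^+ 3); last by ring.
  by rewrite lerXn2r ?nnegrE// mulr_ge0.
have := normrM_le Y2 D2; rewrite ler_norml => /andP[yd _].
have := sqr_ge0 D => D0.
have e30 : 0 <= e ^+ 3 by rewrite exprn_ge0.
have e31 : 2 * e * (2 * e ^+ 2) = 4 * e ^+ 3 by ring.
have -> : 1 - E / 2 + 3 / 8 * E ^+ 2 =
  1 - Y - D / 2 + 3 / 2 * Y ^+ 2 + 3 / 2 * (Y * D) + 3 / 8 * D ^+ 2.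
  by rewrite /E; field.
lra.
Qed.

End unit_steps.

(** * Expectation over one step of the walk *)

Definition Ex (R : realType) (p F : int -> int -> R) : R :=
  \sum_(k <- dirs) \sum_(l <- dirs) p k l * F k l.

Definition is_law (R : realType) (p : int -> int -> R) : Prop :=
  (forall k l, k \in dirs -> l \in dirs -> 0 <= p k l) /\
  \sum_(k <- dirs) \sum_(l <- dirs) p k l = 1.

Section expectation.
Variables (R : realType) (p : int -> int -> R).
Implicit Types F G : int -> int -> R.

Lemma ExD F G : Ex p (fun k l => F k l + G k l) = Ex p F + Ex p G.
Proof.
by rewrite /Ex -big_split; apply: eq_bigr => k _; rewrite -big_split; apply: eq_bigr => l _; rewrite mulrDr.
Qed.

Lemma ExZ c F : Ex p (fun k l => c * F k l) = c * Ex p F.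
Proof.
by rewrite /Ex mulr_sumr; apply: eq_bigr => k _; rewrite mulr_sumr; apply: eq_bigr => l _; rewrite mulrCA.
Qed.

Lemma ExN F : Ex p (fun k l => - F k l) = - Ex p F.
Proof. by rewrite -mulN1r -ExZ; congr Ex; apply/funext=> k; apply/funext=> l; rewrite mulN1r. Qed.

Lemma ExB F G : Ex p (fun k l => F k l - G k l) = Ex p F - Ex p G.
Proof. by rewrite -ExN -ExD. Qed.

Lemma eq_Ex F G : (forall k l, k \in dirs -> l \in dirs -> F k l = G k l) -> Ex p F = Ex p G.
Proof.
move=> FG; rewrite /Ex; apply: eq_big_seq => k kd; apply: eq_big_seq => l ld.
by rewrite FG.
Qed.

Hypothesis law : is_law p.

Lemma Ex_cst c : Ex p (fun _ _ => c) = c.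
Proof.
case: law => _ p1.
rewrite -[RHS]mulr1 -p1 /Ex mulr_sumr; apply: eq_bigr => k _.
by rewrite mulr_sumr; apply: eq_bigr => l _; rewrite mulrC.
Qed.

Lemma Ex_le F G : (forall k l, k \in dirs -> l \in dirs -> F k l <= G k l) ->
  Ex p F <= Ex p G.
Proof.
case: law => p0 _ FG; rewrite /Ex big_seq [leRHS]big_seq; apply: ler_sum => k kd.
by rewrite big_seq [leRHS]big_seq; apply: ler_sum => l ld; rewrite ler_wpM2l ?p0 ?FG.
Qed.

Lemma Ex_dist F G d :
  (forall k l, k \in dirs -> l \in dirs -> `|F k l - G k l| <= d) -> `|Ex p F - Ex p G| <= d.
Proof.
move=> H; rewrite -ExB ler_norml -[X in _ && (_ <= X)]Ex_cst -[X in X <= _]Ex_cst.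
by rewrite !Ex_le// => k l kd ld; have := H k l kd ld; rewrite ler_norml => /andP[].
Qed.

End expectation.

(** * Drift of the angle, the Kelvin transform and the inverse radius under isotropic increments *)

Definition isotropic (R : realType) (p u v : int -> int -> R) (v2 : R) : Prop :=
  [/\ Ex p u = 0, Ex p v = 0, Ex p (fun k l => u k l ^+ 2) = v2,
      Ex p (fun k l => v k l ^+ 2) = v2 & Ex p (fun k l => u k l * v k l) = 0].

Section isotropic_steps.
Variables (R : realType) (p u v : int -> int -> R) (v2 B : R).
Hypotheses (law : is_law p) (iso : isotropic p u v v2).

(** Of a quadratic polynomial in the step only the constant and the trace survive. A harmonic
    function, whose second-order term has trace zero, is thus preserved up to third order. *)
Lemma Ex_iso c0 c1 c2 c3 c4 c5 :
  Ex p (fun k l => c0 + c1 * u k l + c2 * v k l + c3 * u k l ^+ 2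
      + c4 * (u k l * v k l) + c5 * v k l ^+ 2) = c0 + (c3 + c5) * v2.
Proof.
case: iso => u1 v1 uu vv uv.
by rewrite !ExD !ExZ (Ex_cst law) u1 v1 uu vv uv; ring.
Qed.

Hypotheses (uB : forall k l, k \in dirs -> l \in dirs -> `|u k l| <= B)
  (vB : forall k l, k \in dirs -> l \in dirs -> `|v k l| <= B).
Variables P Q r : R.
Hypotheses (r0 : 0 < r) (rPQ : r ^+ 2 = P ^+ 2 + Q ^+ 2) (rB : 16 * B <= r).

Let CS : (P / r) ^+ 2 + (Q / r) ^+ 2 = 1.
Proof. by rewrite !expr_div_n -mulrDl -rPQ divff// expf_neq0// gt_eqF. Qed.

Let step_le x : `|x| <= B -> `|x / r| <= B / r.
Proof. by move=> xB; rewrite normrM normfV (gtr0_norm r0) ler_pM2r ?invr_gt0. Qed.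

Let Br16 : 16 * (B / r) <= 1.
Proof. by rewrite mulrA ler_pdivrMr// mul1r. Qed.

Let rN0 : r != 0. Proof. by rewrite gt_eqF. Qed.

Let normE x y : 1 + (2 * (P / r * (x / r) + Q / r * (y / r)) + ((x / r) ^+ 2 + (y / r) ^+ 2))
  = ((P + x) ^+ 2 + (Q + y) ^+ 2) / r ^+ 2.
Proof.
rewrite (_ : (P + x) ^+ 2 + (Q + y) ^+ 2 = r ^+ 2 + 2 * (P * x + Q * y) + x ^+ 2 + y ^+ 2); first by field.
by rewrite rPQ; ring.
Qed.

(** The polynomial [G] is the second-order expansion of the angle at (P, Q). Its coefficients of
    [u ^+ 2] and [v ^+ 2] are opposite, so its expectation is exactly the old angle. *)
Lemma Ex_atan : 0 < P -> (forall k l, k \in dirs -> l \in dirs -> 0 < P + u k l) ->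
  `|Ex p (fun k l => atan ((Q + v k l) / (P + u k l))) - atan (Q / P)| <= 30 * B ^+ 3 / r ^+ 3.
Proof.
move=> P0 Pu0.
have eE : 30 * B ^+ 3 / r ^+ 3 = 30 * (B / r) ^+ 3 by field.
pose G k l := atan (Q / P) + - Q / r ^+ 2 * u k l + P / r ^+ 2 * v k l
  + P * Q / r ^+ 4 * u k l ^+ 2 + - (P ^+ 2 - Q ^+ 2) / r ^+ 4 * (u k l * v k l)
  + - (P * Q) / r ^+ 4 * v k l ^+ 2.
have -> : atan (Q / P) = Ex p G by rewrite Ex_iso; field.
rewrite eE; apply: (Ex_dist law) => k l kd ld.
have Pr0 : 0 < P / r by rewrite divr_gt0.
have Pur0 : 0 < P / r + u k l / r by rewrite -mulrDl divr_gt0// Pu0.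
have := atan_step CS (step_le (uB kd ld)) (step_le (vB kd ld)) Br16 Pr0 Pur0.
apply: le_trans; rewrite le_eqVlt; apply/orP; left; apply/eqP; congr (`| _ |).
have Pu := Pu0 k l kd ld.
have -> : (Q / r + v k l / r) / (P / r + u k l / r) = (Q + v k l) / (P + u k l).
  by field; rewrite !gt_eqF.
have -> : Q / r / (P / r) = Q / P by field; rewrite !gt_eqF.
by rewrite /G; field.
Qed.

(** Again a harmonic function: the trace of [G] cancels by [rPQ]. Homogeneity of degree -1 gives the
    error one more power of 1/r than for the angle. *)
Lemma Ex_kelvin :
  `|Ex p (fun k l => (P + u k l) / ((P + u k l) ^+ 2 + (Q + v k l) ^+ 2)) - P / r ^+ 2|
    <= 600 * B ^+ 3 / r ^+ 4.
Proof.
pose G k l := P / r ^+ 2 + (r ^- 2 - 2 * P ^+ 2 / r ^+ 4) * u k l + (- (2 * P * Q) / r ^+ 4) * v k l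
  + (4 * P ^+ 3 / r ^+ 6 - 3 * P / r ^+ 4) * u k l ^+ 2
  + (8 * P ^+ 2 * Q / r ^+ 6 - 2 * Q / r ^+ 4) * (u k l * v k l)
  + (4 * P * Q ^+ 2 / r ^+ 6 - P / r ^+ 4) * v k l ^+ 2.
have -> : P / r ^+ 2 = Ex p G.
  rewrite Ex_iso (_ : 4 * P ^+ 3 / r ^+ 6 - 3 * P / r ^+ 4 + _ = 4 * P * (P ^+ 2 + Q ^+ 2) / r ^+ 6 - 4 * P / r ^+ 4).
    by rewrite -rPQ; field.
  by field.
apply: (Ex_dist law) => k l kd ld.
have := kelvin_step CS (step_le (uB kd ld)) (step_le (vB kd ld)) Br16.
have ri0 : 0 < r^-1 by rewrite invr_gt0.
rewrite normE invf_div -(ler_pM2r ri0).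
rewrite (_ : 600 * (B / r) ^+ 3 / r = 600 * B ^+ 3 / r ^+ 4); last by field.
set Z := (X in `|X|); apply: le_trans.
rewrite (_ : _ - _ = Z / r); first by rewrite normrM normfV (gtr0_norm r0).
by rewrite /Z /G; move: ((_ + _) ^-1) => i; field.
Qed.

(** In the plane 1/r is strictly subharmonic, with Laplacian 1/r^3; half of it times [v2] is the
    positive drift from which the barrier draws its gain. *)
Lemma Ex_invsqrt :
  r^-1 + v2 / (2 * r ^+ 3) - 200 * B ^+ 3 / r ^+ 4 <=
  Ex p (fun k l => (Num.sqrt ((P + u k l) ^+ 2 + (Q + v k l) ^+ 2))^-1).
Proof.
pose G k l := (r^-1 - 200 * B ^+ 3 / r ^+ 4) + - P / r ^+ 3 * u k l + - Q / r ^+ 3 * v k l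
  + (3 / 2 * P ^+ 2 / r ^+ 5 - (2 * r ^+ 3)^-1) * u k l ^+ 2
  + 3 * P * Q / r ^+ 5 * (u k l * v k l)
  + (3 / 2 * Q ^+ 2 / r ^+ 5 - (2 * r ^+ 3)^-1) * v k l ^+ 2.
have -> : r^-1 + v2 / (2 * r ^+ 3) - 200 * B ^+ 3 / r ^+ 4 = Ex p G.
  rewrite Ex_iso (_ : (_ + _) * v2 = (3 / 2 * (P ^+ 2 + Q ^+ 2) / r ^+ 5 - (r ^+ 3)^-1) * v2).
    by rewrite -rPQ; field.
  by field.
apply: (Ex_le law) => k l kd ld.
have := invsqrt_step CS (step_le (uB kd ld)) (step_le (vB kd ld)) Br16.
rewrite normE; set W := (X in Num.sqrt (X / _)).
have W0 : 0 <= W by rewrite addr_ge0 ?sqr_ge0.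
rewrite sqrtrM// sqrtrV ?sqr_ge0// sqrtr_sqr gtr0_norm// invf_div.
rewrite -(ler_pM2r (_ : 0 < r^-1)) ?invr_gt0//.
rewrite [leRHS]mulrAC divff// mul1r.
apply: le_trans; rewrite le_eqVlt; apply/orP; left; apply/eqP.
by rewrite /G; field.
Qed.

End isotropic_steps.

Lemma dirs_bound (k : int) : k \in dirs -> -1 <= k <= 1.
Proof. by rewrite !inE => /or3P[] /eqP->. Qed.

(** * Hitting probabilities and comparison with super- and subsolutions *)

Section hitting.
Variables (R : realType) (p : int -> int -> R).
Hypothesis law : is_law p.

Lemma hitN0 x y : hitN p 0 x y = if x == 0 then 1 else 0.
Proof. by rewrite /=; case: ifP => // _; case: ifP. Qed.

Lemma hitN_V N y : hitN p N 0 y = 1.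
Proof. by case: N. Qed.

Lemma hitN_H N x : x != 0 -> hitN p N x 0 = 0.
Proof. by move=> /negPf x0; case: N => [|N] /=; rewrite x0. Qed.

Lemma hitN_int N x y : x != 0 -> y != 0 ->
  hitN p N.+1 x y = Ex p (fun k l => hitN p N (x + k) (y + l)).
Proof. by move=> /negPf x0 /negPf y0; rewrite /= x0 y0. Qed.

Lemma hitN_ge0 N x y : 0 <= hitN p N x y.
Proof.
elim: N x y => [|N IH] x y; first by rewrite hitN0; case: ifP.
have [->|x0] := eqVneq x 0; first by rewrite hitN_V.
have [->|y0] := eqVneq y 0; first by rewrite hitN_H.
by rewrite hitN_int// -(Ex_cst law 0); apply: Ex_le.
Qed.

Lemma hitN_le1 N x y : hitN p N x y <= 1.
Proof.
elim: N x y => [|N IH] x y; first by rewrite hitN0; case: ifP.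
have [->|x0] := eqVneq x 0; first by rewrite hitN_V.
have [->|y0] := eqVneq y 0; first by rewrite hitN_H.
by rewrite hitN_int// -(Ex_cst law 1); apply: Ex_le.
Qed.

Lemma hitN_leS N x y : hitN p N x y <= hitN p N.+1 x y.
Proof.
elim: N x y => [|N IH] x y.
  by rewrite hitN0; have [->|x0] := eqVneq x 0; [rewrite hitN_V|rewrite hitN_ge0].
have [->|x0] := eqVneq x 0; first by rewrite !hitN_V.
have [->|y0] := eqVneq y 0; first by rewrite !hitN_H.
by rewrite !hitN_int//; apply: Ex_le.
Qed.

Lemma hitN_cvg x y : cvgn (fun N => hitN p N x y).
Proof.
apply: nondecreasing_is_cvgn.
  by apply/nondecreasing_seqP => N; exact: hitN_leS.
by exists 1 => _ [N _ <-]; exact: hitN_le1.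
Qed.

Lemma hitN_hitP N x y : hitN p N x y <= hitP p x y.
Proof.
apply: nondecreasing_cvgn_le; last exact: hitN_cvg.
by apply/nondecreasing_seqP => n; exact: hitN_leS.
Qed.

Lemma hitP_le x y c : (forall N, hitN p N x y <= c) -> hitP p x y <= c.
Proof. by move=> H; apply: limr_le; [exact: hitN_cvg|exact: nearW]. Qed.

(** Induction on the horizon; where [1 <= V x y] nothing is to be shown, as [hitN] is at most 1. The
    condition [2 < x + y] keeps the next position away from the origin, where nothing is asked of
    [V]. *)
Lemma hitP_le_super (V : int -> int -> R) :
  (forall x y, 0 <= x -> 0 <= y -> 0 < x + y -> 0 <= V x y) ->
  (forall y, 0 < y -> 1 <= V 0 y) ->
  (forall x y, 0 < x -> 0 < y -> 1 <= V x y \/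
     2 < x + y /\ Ex p (fun k l => V (x + k) (y + l)) <= V x y) ->
  forall x y, 0 < x -> 0 < y -> hitP p x y <= V x y.
Proof.
move=> V0 V1 VE x y x0 y0; apply: hitP_le => N.
have : 0 < x + y by rewrite addr_gt0.
move: x0 y0 => /ltW + /ltW; elim: N x y => [|N IH] x y x0 y0 xy.
  rewrite hitN0; case: eqP x0 xy => [->|_] x0 xy; last exact: V0.
  by apply: V1; rewrite add0r in xy.
have [x_0|xN0] := eqVneq x 0.
  by rewrite x_0 hitN_V; apply: V1; rewrite x_0 add0r in xy.
have [y_0|yN0] := eqVneq y 0.
  by rewrite y_0 hitN_H// -y_0 V0.
have xp : 0 < x by rewrite lt_def xN0.
have yp : 0 < y by rewrite lt_def yN0.
have [|[xy2]] := VE x y xp yp; first by apply: le_trans; exact: hitN_le1.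
apply: le_trans; rewrite hitN_int//; apply: (Ex_le law) => k l /dirs_bound kd /dirs_bound ld.
by apply: IH; lia.
Qed.

(** Here paths not yet absorbed matter: they count 0 in [hitN] although [V] may be close to 1 there.
    Since the first coordinate is centred with positive variance, the cost of stopping at abscissa
    [M] or after finitely many steps can be made arbitrarily small by taking [M] large and then
    [eta] small. *)
Lemma hitP_ge_sub (V : int -> int -> R) :
  Ex p (fun k _ => k%:~R) = 0 -> 0 < Ex p (fun k _ => k%:~R ^+ 2) ->
  (forall x y, 0 <= x -> 0 <= y -> 0 < x + y -> V x y <= 1) ->
  (forall x, 0 < x -> V x 0 <= 0) ->
  (forall x y, 0 < x -> 0 < y -> V x y <= 0 \/
     2 < x + y /\ V x y <= Ex p (fun k l => V (x + k) (y + l))) ->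
  forall x y, 0 < x -> 0 < y -> V x y <= hitP p x y.
Proof.
set a := Ex p (fun k _ => k%:~R ^+ 2).
move=> k0 a0 V1 V0 VE x y x0 y0.
(* G dominates 1 at z = M, and E[G] drops by eta a at each step, so that it
   pays for the walks which are not absorbed in 1 / (eta a) steps. *)
pose G (M : nat) (eta : R) (z : int) : R :=
  z%:~R / M%:R + eta * (z%:~R * (2 * M%:R - z%:~R)).
have G_ge0 M eta z : (0 < M)%N -> 0 <= eta -> 0 <= z -> z <= M%:Z -> 0 <= G M eta z.
  move=> M0 e0 z0 zM; have zR : 0 <= z%:~R :> R by rewrite ler0z.
  have zMR : z%:~R <= M%:R :> R by rewrite -(ler_int R) in zM.
  rewrite addr_ge0 ?divr_ge0 ?mulr_ge0//.
  by have : (0 : R) <= M%:R by []; lra.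
have GE M eta z : Ex p (fun k l => G M eta (z + k)) = G M eta z - eta * a.
  pose c0 := G M eta z; pose c1 : R := M%:R^-1 + eta * (2 * M%:R - 2 * z%:~R).
  transitivity (Ex p (fun k l => c0 + c1 * k%:~R - eta * k%:~R ^+ 2)).
    apply: eq_Ex => k l _ _; rewrite /c0 /c1 /G rmorphD/=.
    by move: M%:R^-1 => i; ring.
  by rewrite ExB ExD !ExZ k0 (Ex_cst law) mulr0 addr0.
(* The [Num.max] term is the part of the budget 1 still unpaid after [N] steps: it is 1 at [N = 0],
   where it bounds [V], and vanishes once [1 <= N%:R * (eta * a)]. *)
have claim M eta N z w : (0 < M)%N -> 0 <= eta -> 0 <= z -> z <= M%:Z -> 0 <= w -> 0 < z + w ->
    V z w - G M eta z <= hitN p N z w + Num.max 0 (1 - N%:R * (eta * a)).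
  move=> M0 e0; elim: N z w => [|N IH] z w z0 zM w0 zw.
    rewrite mul0r subr0 (max_idPr ler01).
    have := V1 _ _ z0 w0 zw; have := hitN_ge0 0 z w; have := G_ge0 M eta z M0 e0 z0 zM; lra.
  set m := Num.max _ _.
  have m0 : 0 <= m by rewrite le_max lexx.
  have Gz := G_ge0 M eta z M0 e0 z0 zM.
  have Vz := V1 _ _ z0 w0 zw.
  have hz := hitN_ge0 N.+1 z w.
  have [z_0|zN0] := eqVneq z 0.
    by move: Gz Vz hz; rewrite z_0 hitN_V; lra.
  have zp : 0 < z by rewrite lt_def zN0.
  have [w_0|wN0] := eqVneq w 0.
    by have := V0 _ zp; rewrite -{1}w_0; lra.
  have wp : 0 < w by rewrite lt_def wN0.
  have [zM'|] := eqVneq z M%:Z.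
    have : 1 <= G M eta z.
      have -> : G M eta z = 1 + eta * (M%:R * M%:R).
        rewrite /G zM' -pmulrn; field; by rewrite pnatr_eq0 -lt0n.
      by rewrite lerDl !mulr_ge0.
    lra.
  have [|[zw2 VEz]] := VE z w zp wp; first lra.
  move=> zNM; have zM1 : z < M%:Z by rewrite lt_def eq_sym zNM.
  set m' := Num.max 0 (1 - N%:R * (eta * a)).
  have step : Ex p (fun k l => V (z + k) (w + l)) - (G M eta z - eta * a)
     <= Ex p (fun k l => hitN p N (z + k) (w + l)) + m'.
    rewrite -GE -ExB -[X in _ + X](Ex_cst law) -ExD; apply: (Ex_le law).
    move=> k l /dirs_bound kd /dirs_bound ld; apply: IH; lia.
  have mm : m' - eta * a <= m.
    rewrite /m /m' lerBlDr; case: (leP 0 (1 - N%:R * (eta * a))) => h.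
      apply: (@le_trans _ _ ((1 - N.+1%:R * (eta * a)) + eta * a)).
        by rewrite -natr1; lra.
      by rewrite lerD2r le_max lexx orbT.
    by rewrite addr_ge0// ?mulr_ge0 ?(ltW a0).
  by rewrite hitN_int//; lra.
have bnd M eta : (0 < M)%N -> x <= M%:Z -> 0 < eta -> V x y - G M eta x <= hitP p x y.
  move=> M0 xM e0.
  have ea0 : 0 < eta * a by rewrite mulr_gt0.
  have [N] : exists N : nat, 1 <= N%:R * (eta * a).
    exists (Num.bound (eta * a)^-1); rewrite -ler_pdivrMr// div1r.
    by rewrite ltW// archi_boundP// invr_ge0 ltW.
  move=> NE; apply: le_trans (hitN_hitP N x y).
  have := claim M eta N x y M0 (ltW e0) (ltW x0) xM (ltW y0) (addr_gt0 x0 y0).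
  by rewrite (max_idPl _) ?addr0// subr_le0.
have x0R : 0 < x%:~R :> R by rewrite ltr0z.
rewrite -subr_le0 leNgt; apply/negP => d0.
set d := V x y - hitP p x y in d0.
(* [M] brings the first term of [G] below [d / 2] and [eta] brings the second below [d / 4], against
   [d <= G M eta x]. *)
pose M := (Num.bound (2 * x%:~R / d) + absz x)%N.
have M0 : (0 < M)%N by rewrite /M; lia.
have M0R : 0 < M%:R :> R by rewrite ltr0n.
have Mx : x <= M%:Z by rewrite /M; lia.
pose eta : R := d / (4 * (x%:~R * (2 * M%:R))).
have e0 : 0 < eta by rewrite divr_gt0// !mulr_gt0.
have := bnd M eta M0 Mx e0; rewrite /G.
have h1 : x%:~R / M%:R <= d / 2.
  rewrite ler_pdivrMr// mulrC -ler_pdivrMr ?divr_gt0// invf_div mulrA [_ * 2]mulrC.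
  have : 0 <= 2 * x%:~R / d by rewrite divr_ge0 ?mulr_ge0 ?ltW.
  move=> /archi_boundP /ltW /le_trans; apply.
  by rewrite /M natrD lerDl.
have h2 : eta * (x%:~R * (2 * M%:R - x%:~R)) <= d / 4.
  apply: (@le_trans _ _ (eta * (x%:~R * (2 * M%:R)))).
    by rewrite !ler_wpM2l ?(ltW e0) ?(ltW x0R)// lerBlDr lerDl ltW.
  rewrite /eta le_eqVlt; apply/orP; left; apply/eqP; field.
  by rewrite !gt_eqF.
by rewrite /d in d0 h1 h2 *; lra.
Qed.

End hitting.

Lemma int_add_le2 (z w : int) : 0 < z -> 0 < w -> z + w <= 2 -> z = 1 /\ w = 1.
Proof. lia. Qed.

(** * Geometry of the cone: the angle and the barrier on the quadrant *)

Section cone.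
Variables (R : realType) (s t al be : R).
Implicit Types x y : R.

(* Isotropic coordinates and their norm; ang is the angle rescaled to [0, 1], and bar the
   difference of the harmonic function cos theta / (al r) and of 1 / r.  At the origin
   all of them take junk values. *)
Definition cP x y : R := al * (s * x + t * y).
Definition cQ x y : R := be * (t * y - s * x).
Definition cr x y : R := Num.sqrt (cP x y ^+ 2 + cQ x y ^+ 2).
Definition ang x y : R := 2^-1 + atan (cQ x y / cP x y) / (2 * atan (be / al)).
Definition bar x y : R := cP x y / (al * (cP x y ^+ 2 + cQ x y ^+ 2)) - (cr x y)^-1.

Lemma cP_add x y k l : cP (x + k) (y + l) = cP x y + cP k l.
Proof. by rewrite /cP; ring. Qed.

Lemma cQ_add x y k l : cQ (x + k) (y + l) = cQ x y + cQ k l.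
Proof. by rewrite /cQ; ring. Qed.

Lemma cr_sqr x y : cr x y ^+ 2 = cP x y ^+ 2 + cQ x y ^+ 2.
Proof. by rewrite sqr_sqrtr// addr_ge0 ?sqr_ge0. Qed.

Lemma cr_ge0 x y : 0 <= cr x y. Proof. exact: sqrtr_ge0. Qed.

Hypotheses (s0 : 0 < s) (t0 : 0 < t) (al0 : 0 < al) (be0 : 0 < be).
Hypothesis albe : al ^+ 2 + be ^+ 2 = 1.

Lemma al_le1 : al <= 1.
Proof. by rewrite -(@expr_le1 _ 2) ?(ltW al0)// -albe lerDl sqr_ge0. Qed.

Lemma be_le1 : be <= 1.
Proof. by rewrite -(@expr_le1 _ 2) ?(ltW be0)// -albe lerDr sqr_ge0. Qed.

Lemma atan_ratio_gt0 : 0 < atan (be / al).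
Proof. by rewrite -(@atan0 R) lt_atan// divr_gt0. Qed.

Section quadrant.
Variables x y : R.
Hypotheses (x0 : 0 <= x) (y0 : 0 <= y) (xy0 : 0 < x + y).

Lemma ell_gt0 : 0 < s * x + t * y.
Proof.
have sx : 0 <= s * x by rewrite mulr_ge0// ltW.
have [y_0|yN0] := eqVneq y 0.
  by move: xy0; rewrite y_0 mulr0 !addr0 => x_gt0; rewrite mulr_gt0.
by rewrite ltr_wpDl// mulr_gt0// lt_def yN0.
Qed.

Lemma cP_gt0 : 0 < cP x y.
Proof. by rewrite mulr_gt0// ell_gt0. Qed.

Lemma cQ_le : `|t * y - s * x| <= s * x + t * y.
Proof.
have sx : 0 <= s * x by rewrite mulr_ge0// ltW.
have ty : 0 <= t * y by rewrite mulr_ge0// ltW.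
by rewrite ler_norml; apply/andP; split; lra.
Qed.

Lemma cr_sqrB : (s * x + t * y) ^+ 2 - cr x y ^+ 2 = 4 * s * t * be ^+ 2 * (x * y).
Proof.
rewrite cr_sqr /cP /cQ !exprMn (_ : al ^+ 2 = 1 - be ^+ 2); first by ring.
by rewrite -albe addrK.
Qed.

Lemma cr_le : cr x y <= s * x + t * y.
Proof.
rewrite -ler_sqr ?nnegrE ?cr_ge0 ?(ltW ell_gt0)// -subr_ge0 cr_sqrB.
by rewrite !mulr_ge0 ?exprn_ge0 ?(ltW s0) ?(ltW t0) ?(ltW be0).
Qed.

Lemma cr_ge : cP x y <= cr x y.
Proof.
rewrite -ler_sqr ?nnegrE ?cr_ge0 ?(ltW cP_gt0)// cr_sqr lerDl sqr_ge0//.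
Qed.

Lemma cr_gt0 : 0 < cr x y.
Proof. exact: lt_le_trans cP_gt0 cr_ge. Qed.

(** With L = s x + t y, which is [cP x y / al], and r = [cr x y], the barrier is (L - r) / r^2.
    Multiplying by L + r and using [cr_sqrB] exhibits the factor [x * y], hence the sign and the
    vanishing on the axes. *)
Lemma barE : bar x y = 4 * s * t * be ^+ 2 * (x * y) / (cr x y ^+ 2 * (s * x + t * y + cr x y)).
Proof.
have L0 := ell_gt0; have r0 := cr_gt0.
rewrite /bar -cr_sqr -cr_sqrB /cP; field.
by rewrite !gt_eqF// addr_gt0.
Qed.

Lemma bar_ge0 : 0 <= bar x y.
Proof.
have L0 := ell_gt0; have r0 := cr_gt0.
rewrite barE !mulr_ge0 ?exprn_ge0 ?invr_ge0 ?mulr_ge0 ?exprn_ge0//; apply: ltW => //.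
by rewrite addr_gt0.
Qed.

(** From r >= al L. For fixed [y] this is the decay of order x^-2 that makes the barrier negligible
    against the angle. *)
Lemma bar_le : bar x y <= 4 * s * t * be ^+ 2 / al ^+ 2 * (x * y) / (s * x + t * y) ^+ 3.
Proof.
have L0 := ell_gt0; have r0 := cr_gt0; have Pr := cr_ge.
have -> : 4 * s * t * be ^+ 2 / al ^+ 2 * (x * y) / (s * x + t * y) ^+ 3 =
  4 * s * t * be ^+ 2 * (x * y) / (cP x y ^+ 2 * (s * x + t * y)).
  by rewrite /cP; field; rewrite !gt_eqF.
rewrite barE ler_wpM2l ?mulr_ge0 ?exprn_ge0 ?(ltW s0) ?(ltW t0) ?(ltW be0)//.
have P0 := cP_gt0; have Lr := addr_gt0 L0 r0.
rewrite lef_pV2 ?posrE; last 2 first.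
- by rewrite mulr_gt0 ?exprn_gt0.
- by rewrite mulr_gt0 ?exprn_gt0.
rewrite ler_pM ?exprn_ge0 ?(ltW cP_gt0) ?(ltW L0)// ?lerDl ?(ltW r0)//.
by rewrite lerXn2r ?nnegrE ?(ltW cP_gt0) ?(ltW r0).
Qed.

(** From r <= L; this bound keeps the barrier away from 0 at interior lattice points of a bounded
    region. *)
Lemma bar_ge : 2 * s * t * be ^+ 2 * (x * y) / (s * x + t * y) ^+ 3 <= bar x y.
Proof.
have L0 := ell_gt0; have r0 := cr_gt0; have rl := cr_le.
have -> : 2 * s * t * be ^+ 2 * (x * y) / (s * x + t * y) ^+ 3 =
  4 * s * t * be ^+ 2 * (x * y) / ((s * x + t * y) ^+ 2 * (s * x + t * y + (s * x + t * y))).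
  by move: (s * x + t * y) L0 => L L0; field; rewrite !gt_eqF // addr_gt0.
rewrite barE ler_wpM2l ?mulr_ge0 ?exprn_ge0 ?(ltW s0) ?(ltW t0) ?(ltW be0)//.
have Lr := addr_gt0 L0 r0; have LL := addr_gt0 L0 L0.
rewrite lef_pV2 ?posrE; last 2 first.
- by rewrite mulr_gt0 ?exprn_gt0.
- by rewrite mulr_gt0 ?exprn_gt0.
rewrite ler_pM ?exprn_ge0 ?(ltW r0) ?(ltW Lr) ?lerD2l//.
by rewrite lerXn2r ?nnegrE ?(ltW L0) ?(ltW r0).
Qed.

(** The last ratio stays between -1 and 1, with -1 reached on the horizontal axis and 1 on the
    vertical one; this is what normalises [ang]. *)
Lemma cQP : cQ x y / cP x y = be / al * ((t * y - s * x) / (s * x + t * y)).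
Proof. by have L0 := ell_gt0; rewrite /cQ /cP; field; rewrite !gt_eqF. Qed.

Lemma ang01 : 0 <= ang x y <= 1.
Proof.
have L0 := ell_gt0; have k0 := atan_ratio_gt0.
have : `|(t * y - s * x) / (s * x + t * y)| <= 1.
  by rewrite normrM normfV (gtr0_norm L0) ler_pdivrMr// mul1r cQ_le.
rewrite ler_norml /ang cQP => /andP[m1 m2].
have bal : 0 <= be / al by rewrite divr_ge0 ?ltW.
have h2 : atan (be / al * ((t * y - s * x) / (s * x + t * y))) <= atan (be / al).
  by rewrite le_atan// ler_piMr.
have h1 : - atan (be / al) <= atan (be / al * ((t * y - s * x) / (s * x + t * y))).
  by rewrite -atanN le_atan// -[leLHS]mulrN1 ler_wpM2l.
move: (atan (be / al * _)) h1 h2 => A h1 h2; move: (atan _) k0 h1 h2 => K k0 h1 h2.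
have -> : 2^-1 + A / (2 * K) = (K + A) / (2 * K) by field; rewrite gt_eqF.
rewrite divr_ge0 ?ler_pdivrMr ?mulr_gt0//=; lra.
Qed.

End quadrant.

Lemma ang_V y : 0 < y -> ang 0 y = 1.
Proof.
move=> y0; have k0 := atan_ratio_gt0.
rewrite /ang cQP ?add0r ?(ltW y0)// mulr0 subr0 add0r divff ?mulr1 ?mulf_neq0 ?gt_eqF//.
by field; rewrite gt_eqF.
Qed.

Lemma ang_H x : 0 < x -> ang x 0 = 0.
Proof.
move=> x0; have k0 := atan_ratio_gt0.
rewrite /ang cQP ?addr0 ?(ltW x0)// mulr0 sub0r addr0 mulNr divff ?mulf_neq0 ?gt_eqF//.
by rewrite mulrN1 atanN; field; rewrite gt_eqF.
Qed.

Lemma bar_V y : 0 < y -> bar 0 y = 0.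
Proof. by move=> y0; rewrite barE ?add0r ?(ltW y0)// mul0r mulr0 mul0r. Qed.

Lemma bar_H x : 0 < x -> bar x 0 = 0.
Proof. by move=> x0; rewrite barE ?addr0 ?(ltW x0)// !mulr0 mul0r. Qed.

(** * Comparison of the walk with the angle, with the barrier as error term *)

Section walk.
Variable p : int -> int -> R.
Hypothesis law : is_law p.
Hypotheses (Ek : Ex p (fun k _ => k%:~R) = 0) (El : Ex p (fun _ l => l%:~R) = 0).
Hypotheses (Ekk : Ex p (fun k _ => k%:~R ^+ 2) = t ^+ 2)
  (Ell : Ex p (fun _ l => l%:~R ^+ 2) = s ^+ 2)
  (Ekl : Ex p (fun k l => k%:~R * l%:~R) = s * t * (be ^+ 2 - al ^+ 2)).

(* v2 = E[k^2] E[l^2] - E[k l]^2 *)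
Let v2 := (2 * s * t * al * be) ^+ 2.
Let du k l := cP k%:~R l%:~R.
Let dv k l := cQ k%:~R l%:~R.

(** The crossed scaling gives s k and t l the common variance s^2 t^2, so their sum and difference
    are uncorrelated. Their variances are 4 s^2 t^2 be^2 and 4 s^2 t^2 al^2 by [Ekl], and the
    factors [al] and [be] make them equal. *)
Lemma cone_isotropic : isotropic p du dv v2.
Proof.
have be2 : be ^+ 2 = 1 - al ^+ 2 by rewrite -albe [al ^+ 2 + _]addrC addrK.
have q2 c1 c2 c3 : Ex p (fun k l => c1 * k%:~R ^+ 2 + c2 * (k%:~R * l%:~R) + c3 * l%:~R ^+ 2)
   = c1 * t ^+ 2 + c2 * (s * t * (be ^+ 2 - al ^+ 2)) + c3 * s ^+ 2.
  by rewrite !ExD !ExZ Ekk Ekl Ell.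
split.
- transitivity (Ex p (fun k l => al * s * k%:~R + al * t * l%:~R)).
    by apply: eq_Ex => k l _ _; rewrite /du /cP; ring.
  by rewrite ExD !ExZ Ek El !mulr0 addr0.
- transitivity (Ex p (fun k l => - be * s * k%:~R + be * t * l%:~R)).
    by apply: eq_Ex => k l _ _; rewrite /dv /cQ; ring.
  by rewrite ExD !ExZ Ek El !mulr0 addr0.
- rewrite -[LHS](_ : Ex p (fun k l => (al * s) ^+ 2 * k%:~R ^+ 2
      + 2 * al ^+ 2 * s * t * (k%:~R * l%:~R) + (al * t) ^+ 2 * l%:~R ^+ 2) = _).
    by rewrite q2 /v2 !exprMn be2; ring.
  by apply: eq_Ex => k l _ _; rewrite /du /cP; ring.
- rewrite -[LHS](_ : Ex p (fun k l => (be * s) ^+ 2 * k%:~R ^+ 2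
      + - (2 * be ^+ 2 * s * t) * (k%:~R * l%:~R) + (be * t) ^+ 2 * l%:~R ^+ 2) = _).
    by rewrite q2 /v2 !exprMn be2; ring.
  by apply: eq_Ex => k l _ _; rewrite /dv /cQ; ring.
- rewrite -[LHS](_ : Ex p (fun k l => - (al * be * s ^+ 2) * k%:~R ^+ 2
      + 0 * (k%:~R * l%:~R) + (al * be * t ^+ 2) * l%:~R ^+ 2) = _).
    by rewrite q2; ring.
  by apply: eq_Ex => k l _ _; rewrite /du /dv /cP /cQ; ring.
Qed.

Lemma dirs_normr (k : int) : k \in dirs -> `|k%:~R| <= 1 :> R.
Proof. by rewrite !inE => /or3P[] /eqP->; rewrite ?normrN ?normr0 ?normr1. Qed.

Lemma du_le k l : k \in dirs -> l \in dirs -> `|du k l| <= s + t.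
Proof.
move=> /dirs_normr k1 /dirs_normr l1; rewrite -[leRHS]mul1r; apply: normrM_le.
  by rewrite gtr0_norm// al_le1.
apply: (le_trans (ler_normD _ _)).
by apply: lerD; rewrite normrM gtr0_norm// ler_piMr// ltW.
Qed.

Lemma dv_le k l : k \in dirs -> l \in dirs -> `|dv k l| <= s + t.
Proof.
move=> /dirs_normr k1 /dirs_normr l1; rewrite -[leRHS]mul1r; apply: normrM_le.
  by rewrite gtr0_norm// be_le1.
apply: (le_trans (ler_normB _ _)).
by rewrite addrC; apply: lerD; rewrite normrM gtr0_norm// ler_piMr// ltW.
Qed.

Let B := s + t.
(** Joint error constant of [Ex_kelvin], divided by [al], and [Ex_invsqrt]. *)
Let K1 := (600 / al + 200) * B ^+ 3.
(* Beyond the radius rad the main term - v2 / (2 r^3) of the drift of bar is at least twice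
   the error term K1 / r^4. *)
Let rad := 16 * B / al + 4 * K1 / v2.
Let Cu := 30 * B ^+ 3 / (2 * atan (be / al)).

Let B0 : 0 < B. Proof. by rewrite addr_gt0. Qed.
Let v20 : 0 < v2. Proof. by rewrite exprn_gt0// !mulr_gt0. Qed.
Let K10 : 0 < K1.
Proof.
have b0 := B0; apply: mulr_gt0; last exact: exprn_gt0.
by apply: addr_gt0; [apply: divr_gt0; [rewrite ltr0n|]|rewrite ltr0n].
Qed.

Let Cu0 : 0 < Cu.
Proof.
have b0 := B0; have k0 := atan_ratio_gt0; rewrite /Cu; apply: divr_gt0.
  by apply: mulr_gt0; [rewrite ltr0n|exact: exprn_gt0].
by apply: mulr_gt0; first rewrite ltr0n.
Qed.

Let rad0 : 0 < rad.
Proof.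
have b0 := B0; have v0 := v20; have k1 := K10; rewrite /rad; apply: addr_gt0.
  by apply: divr_gt0 => //; apply: mulr_gt0; first rewrite ltr0n.
by apply: divr_gt0 => //; apply: mulr_gt0; first rewrite ltr0n.
Qed.

Section far.
Variables x y : R.
Hypotheses (x0 : 0 <= x) (y0 : 0 <= y) (xy0 : 0 < x + y) (far : rad <= cr x y).

Let Bfar : 16 * B / al <= cr x y.
Proof. by apply: le_trans far; rewrite lerDl ltW// divr_gt0// mulr_gt0. Qed.

Let B16 : 16 * B <= cr x y.
Proof.
apply: le_trans Bfar; rewrite ler_peMr ?mulr_ge0 ?(ltW B0)//.
by rewrite invf_ge1 ?al_le1.
Qed.

(** The first summand of [rad] serves here: [cP x y] is al L >= al r >= 16 B, more than any
    increment can undo, so the arctangent stays on one branch. *)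
Let Pdu k l : k \in dirs -> l \in dirs -> 0 < cP x y + du k l.
Proof.
move=> kd ld; have := du_le kd ld; rewrite -/B ler_norml => /andP[h _].
have := Bfar; rewrite ler_pdivrMr// => h2.
have := cr_le x0 y0 xy0; rewrite -(ler_pM2l al0) => h3.
have B0' := B0; rewrite /cP in h3 *; move: h h2 h3; rewrite /du /cP; lra.
Qed.

Lemma ang_far : `|Ex p (fun k l => ang (x + k%:~R) (y + l%:~R)) - ang x y| <= Cu / cr x y ^+ 3.
Proof.
have k0 := atan_ratio_gt0; have r0 := cr_gt0 x0 y0 xy0.
have := Ex_atan law cone_isotropic du_le dv_le r0 (cr_sqr x y) B16 (cP_gt0 x0 y0 xy0) Pdu.
set i := (2 * atan (be / al))^-1.
have i0 : 0 < i by rewrite invr_gt0 mulr_gt0.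
rewrite -(ler_pM2r i0) -/B.
have -> : 30 * B ^+ 3 / cr x y ^+ 3 * i = Cu / cr x y ^+ 3 by rewrite /Cu -/i mulrAC.
set Z := (X in `|X|); apply: le_trans.
rewrite (_ : _ - _ = Z * i); first by rewrite normrM (gtr0_norm i0).
rewrite /Z.
rewrite (@eq_Ex _ _ _ (fun k l => 2^-1 + i * atan ((cQ x y + dv k l) / (cP x y + du k l)))).
  by rewrite ExD ExZ (Ex_cst law) /ang -/i; ring.
by move=> k l _ _; rewrite /ang cP_add cQ_add mulrC.
Qed.

(** The Kelvin part has no second-order drift and -1/r contributes -v2 / (2 r^3). The errors of
    order r^-4 consume at most half of that. *)
Lemma bar_far : Ex p (fun k l => bar (x + k%:~R) (y + l%:~R)) <= bar x y - v2 / 4 / cr x y ^+ 3.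
Proof.
have r0 := cr_gt0 x0 y0 xy0.
have := Ex_kelvin law cone_isotropic du_le dv_le r0 (cr_sqr x y) B16.
have := Ex_invsqrt law cone_isotropic du_le dv_le r0 (cr_sqr x y) B16.
rewrite -/B => h1; rewrite ler_norml => /andP[_ h2].
rewrite (@eq_Ex _ _ _ (fun k l => al^-1 * ((cP x y + du k l)
    / ((cP x y + du k l) ^+ 2 + (cQ x y + dv k l) ^+ 2))
  - (Num.sqrt ((cP x y + du k l) ^+ 2 + (cQ x y + dv k l) ^+ 2))^-1)); last first.
  move=> k l _ _; rewrite /bar /cr !cP_add !cQ_add -/(du k l) -/(dv k l).
  by rewrite invfM mulrCA.
rewrite ExB ExZ /bar.
rewrite -cr_sqr.
move: (Ex p _) (Ex p _) h1 h2 => e2 e1 h1 h2.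
have h3 : al^-1 * e2 <= al^-1 * (cP x y / cr x y ^+ 2 + 600 * B ^+ 3 / cr x y ^+ 4).
  by rewrite ler_pM2l ?invr_gt0// -lerBlDl.
have h4 : K1 / cr x y ^+ 4 <= v2 / 4 / cr x y ^+ 3.
  have f : 4 * K1 / v2 <= cr x y.
    by apply: le_trans far; rewrite lerDr ltW// divr_gt0// ?mulr_gt0.
  rewrite ler_pdivrMr// in f.
  rewrite ler_pdivrMr ?exprn_gt0//.
  have -> : v2 / 4 / cr x y ^+ 3 * cr x y ^+ 4 = v2 / 4 * cr x y by field; rewrite gt_eqF.
  move: f; lra.
have h5 : al^-1 * (600 * B ^+ 3 / cr x y ^+ 4) + 200 * B ^+ 3 / cr x y ^+ 4 = K1 / cr x y ^+ 4.
  by rewrite /K1; field; rewrite !gt_eqF.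
have h6 : v2 / (2 * cr x y ^+ 3) = 2 * (v2 / 4 / cr x y ^+ 3) by field; rewrite !gt_eqF.
have h7 : cP x y / (al * cr x y ^+ 2) = al^-1 * (cP x y / cr x y ^+ 2) by field; rewrite !gt_eqF.
move: h1 h3 h4 h5 h6 h7.
by rewrite mulrDr; lra.
Qed.

(** Excludes the point (1, 1), where [cr] is at most s + t: it is the only interior point from which
    the origin can be reached in one step. *)
Lemma far_gt : B < cr x y.
Proof. by have := B16; have := B0; lra. Qed.

End far.

(* The first summand beats the defect of harmonicity of ang beyond rad, the second makes
   bar_cst * bar >= 1 within rad. *)
Definition bar_cst := 4 * Cu / v2 + (rad / al) ^+ 3 / (2 * s * t * be ^+ 2).

Lemma bar_cst_gt0 : 0 < bar_cst.
Proof.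
have k0 := atan_ratio_gt0; have v0 := v20; have k1 := K10; have b0 := B0.
have c0 := Cu0.
have r0' := rad0.
rewrite /bar_cst; apply: addr_gt0; apply: divr_gt0 => //.
- by apply: mulr_gt0; first rewrite ltr0n.
- by apply: exprn_gt0; apply: divr_gt0.
- by rewrite !mulr_gt0// exprn_gt0.
Qed.

(** Here L <= rad / al because al L = [cP x y] is at most r, and [1 <= x * y] at interior lattice
    points; [bar_ge] then applies. *)
Lemma bar_near x y : 1 <= x -> 1 <= y -> cr x y < rad -> 1 <= bar_cst * bar x y.
Proof.
move=> x1 y1 near.
have x0 : 0 <= x by lra.
have y0 : 0 <= y by lra.
have xy0 : 0 < x + y by lra.
have L0 := ell_gt0 x0 y0 xy0.
have k0 := atan_ratio_gt0; have v0 := v20; have b0 := B0.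
have c0 := Cu0.
have Lrad : s * x + t * y <= rad / al.
  by rewrite ler_pdivlMr// mulrC; apply: le_trans (ltW near); exact: cr_ge.
have L3 : (s * x + t * y) ^+ 3 <= (rad / al) ^+ 3.
  by rewrite lerXn2r ?nnegrE ?(ltW L0)// (le_trans _ Lrad)// ltW.
have st0 : 0 < 2 * s * t * be ^+ 2 by rewrite !mulr_gt0// exprn_gt0.
have xy1 : 1 <= x * y by rewrite mulr_ege1.
have h1 : (rad / al) ^+ 3 / (2 * s * t * be ^+ 2) * bar x y <= bar_cst * bar x y.
  by rewrite ler_wpM2r ?bar_ge0// lerDr ltW// divr_gt0// mulr_gt0.
apply: le_trans h1.
have h2 := bar_ge x0 y0 xy0.
have R3 : 0 <= (rad / al) ^+ 3 by apply: le_trans L3; rewrite exprn_ge0// ltW.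
apply: (@le_trans _ _ ((rad / al) ^+ 3 / (2 * s * t * be ^+ 2) *
   (2 * s * t * be ^+ 2 * (x * y) / (s * x + t * y) ^+ 3))); last first.
  by rewrite ler_wpM2l// divr_ge0// ltW.
rewrite mulrA mulrA divfK ?gt_eqF// ler_pdivlMr ?exprn_gt0// mul1r.
by apply: (le_trans L3); rewrite ler_peMr.
Qed.

Lemma bar_cst_far x y : 0 < cr x y -> Cu / cr x y ^+ 3 <= bar_cst * (v2 / 4 / cr x y ^+ 3).
Proof.
move=> r0; have k0 := atan_ratio_gt0; have v0 := v20; have b0 := B0; have k1 := K10.
have r0' := rad0.
rewrite mulrA ler_pM2r ?invr_gt0 ?exprn_gt0// /bar_cst mulrDl.
rewrite (_ : 4 * Cu / v2 * (v2 / 4) = Cu); last by field; rewrite gt_eqF.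
rewrite lerDl mulr_ge0// ?divr_ge0 ?exprn_ge0 ?divr_ge0 ?mulr_ge0 ?exprn_ge0//; exact: ltW.
Qed.

(** The angle plus or minus [bar_cst] times [bar] is a super- or subsolution. Beyond [rad] the drift
    of the barrier absorbs that of the angle; within [rad] the barrier term exceeds 1 and the
    comparison is trivial. *)
Lemma hitP_ang (x y : int) : 0 < x -> 0 < y ->
  `|hitP p x y - ang x%:~R y%:~R| <= bar_cst * bar x%:~R y%:~R.
Proof.
move=> x0 y0.
have c0 := bar_cst_gt0.
have real_xy (z w : int) : 0 <= z -> 0 <= w -> 0 < z + w ->
    [/\ 0 <= z%:~R :> R, 0 <= w%:~R :> R & 0 < z%:~R + w%:~R :> R].
  by move=> *; rewrite -rmorphD/= !ler0z ltr0z.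
have angb (z w : int) : 0 <= z -> 0 <= w -> 0 < z + w -> 0 <= ang z%:~R w%:~R <= 1.
  by move=> z0 w0 zw; have [zR wR zwR] := real_xy _ _ z0 w0 zw; exact: ang01.
have barb (z w : int) : 0 <= z -> 0 <= w -> 0 < z + w -> 0 <= bar_cst * bar z%:~R w%:~R.
  move=> z0 w0 zw; have [zR wR zwR] := real_xy _ _ z0 w0 zw.
  by rewrite mulr_ge0 ?(ltW c0)// bar_ge0.
have cases (z w : int) : 0 < z -> 0 < w -> 1 <= bar_cst * bar z%:~R w%:~R \/
    [/\ 2 < z + w,
     `|Ex p (fun k l => ang (z + k)%:~R (w + l)%:~R) - ang z%:~R w%:~R|
        <= Cu / cr z%:~R w%:~R ^+ 3
     & bar_cst * Ex p (fun k l => bar (z + k)%:~R (w + l)%:~R) <= bar_cst * bar z%:~R w%:~R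
         - Cu / cr z%:~R w%:~R ^+ 3].
  move=> z0 w0; have [zR wR zwR] := real_xy _ _ (ltW z0) (ltW w0) (addr_gt0 z0 w0).
  have [far|near] := leP rad (cr z%:~R w%:~R); last first.
    by left; apply: bar_near => //; rewrite ler1z -gtz0_ge1.
  right; split.
  - have [//|zw] := ltP 2 (z + w).
    have [z1 w1] := int_add_le2 z0 w0 zw.
    have := far_gt far; have := cr_le zR wR zwR.
    by rewrite z1 w1 !mulr1 => /le_lt_trans /[apply]; rewrite ltxx.
  - rewrite (@eq_Ex _ _ _ (fun k l => ang (z%:~R + k%:~R) (w%:~R + l%:~R))).
      exact: ang_far.
    by move=> k l _ _; rewrite !rmorphD.
  - rewrite (@eq_Ex _ _ _ (fun k l => bar (z%:~R + k%:~R) (w%:~R + l%:~R))); last first.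
      by move=> k l _ _; rewrite !rmorphD.
    apply: (le_trans (ler_wpM2l (ltW c0) (bar_far zR wR zwR far))).
    by rewrite mulrBr lerB// bar_cst_far// (cr_gt0 zR wR zwR).
rewrite ler_distl; apply/andP; split.
- apply: (hitP_ge_sub law (V := fun z w => ang z%:~R w%:~R - bar_cst * bar z%:~R w%:~R)) => //.
  + by rewrite Ekk exprn_gt0.
  + by move=> z w z0 w0 zw; have /andP[_] := angb _ _ z0 w0 zw; have := barb _ _ z0 w0 zw; lra.
  + move=> z z0; have zR : 0 < z%:~R :> R by rewrite ltr0z.
    by rewrite ang_H// bar_H// mulr0 subrr.
  + move=> z w z0 w0; have /andP[_ a1] := angb _ _ (ltW z0) (ltW w0) (addr_gt0 z0 w0).
    have [b1|[zw]] := cases _ _ z0 w0; first by left; lra.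
    rewrite ler_distl => /andP[h1 h2] h3; right; split=> //.
    by rewrite ExB ExZ; lra.
- apply: (hitP_le_super law (V := fun z w => ang z%:~R w%:~R + bar_cst * bar z%:~R w%:~R)) => //.
  + by move=> z w z0 w0 zw; have /andP[] := angb _ _ z0 w0 zw; have := barb _ _ z0 w0 zw; lra.
  + move=> z z0; have zR : 0 < z%:~R :> R by rewrite ltr0z.
    by rewrite ang_V// bar_V// mulr0 addr0.
  + move=> z w z0 w0; have /andP[a1 _] := angb _ _ (ltW z0) (ltW w0) (addr_gt0 z0 w0).
    have [b1|[zw]] := cases _ _ z0 w0; first by left; lra.
    rewrite ler_distl => /andP[h1 h2] h3; right; split=> //.
    by rewrite ExD ExZ; lra.
Qed.

End walk.
End cone.

(** * Behaviour of the angle near the horizontal axis *)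

Section asymptotics.
Variables (R : realType) (s t al be : R).
Hypotheses (s0 : 0 < s) (t0 : 0 < t) (al0 : 0 < al) (be0 : 0 < be).
Hypothesis albe : al ^+ 2 + be ^+ 2 = 1.

(** The coefficient of y/x in the leading term of [angE], that is, the constant A of the theorem. *)
Definition ang_cst : R := al * be * t / (s * atan (be / al)).

Lemma ang_cst_gt0 : 0 < ang_cst.
Proof. by rewrite divr_gt0 ?mulr_gt0// atan_ratio_gt0. Qed.

(* Subtraction formula for atan: unlike in the definition of ang, the argument is small
   near the horizontal axis. *)
Lemma angE x y : 0 < x -> 0 < y -> 2 * t * y <= s * x ->
  ang s t al be x y =
    atan (2 * al * be * t * y / (s * x + (al ^+ 2 - be ^+ 2) * (t * y))) / (2 * atan (be / al)).
Proof.
move=> x0 y0 xy; have k0 := atan_ratio_gt0 al0 be0.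
have sx0 : 0 < s * x by rewrite mulr_gt0.
have ty0 : 0 < t * y by rewrite mulr_gt0.
have xy' : 0 <= s * x - 2 * (t * y) by rewrite mulrA subr_ge0.
have L0 : 0 < s * x + t * y by rewrite addr_gt0.
have E : 1 + be / al * (be / al * ((s * x - t * y) / (s * x + t * y))) =
  (s * x + (al ^+ 2 - be ^+ 2) * (t * y)) / (al ^+ 2 * (s * x + t * y)).
  have -> : s * x + (al ^+ 2 - be ^+ 2) * (t * y) =
    (al ^+ 2 + be ^+ 2) * (s * x) + (al ^+ 2 - be ^+ 2) * (t * y) by rewrite albe mul1r.
  by field; rewrite !gt_eqF.
have bal : 0 < be / al by rewrite divr_gt0.
have D0 : 0 < s * x + (al ^+ 2 - be ^+ 2) * (t * y).
  have -> : s * x + (al ^+ 2 - be ^+ 2) * (t * y)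
      = s * x - (al ^+ 2 + be ^+ 2) * (t * y) + 2 * al ^+ 2 * (t * y) by ring.
  rewrite albe mul1r.
  by rewrite ltr_wpDl ?mulr_gt0 ?exprn_gt0//; lra.
have -> : 2 * al * be * t * y / (s * x + (al ^+ 2 - be ^+ 2) * (t * y)) =
   (be / al - be / al * ((s * x - t * y) / (s * x + t * y))) /
   (1 + be / al * (be / al * ((s * x - t * y) / (s * x + t * y)))).
  by rewrite E; field; rewrite !gt_eqF.
rewrite -atanB; last first.
  have m0 : 0 <= (s * x - t * y) / (s * x + t * y) by apply: divr_ge0; lra.
  by rewrite ltr_wpDr// mulr_ge0 ?(ltW bal)// mulr_ge0 ?(ltW bal).
rewrite /ang cQP ?(ltW x0) ?(ltW y0) ?addr_gt0//.
rewrite -[t * y - s * x]opprB mulNr mulrN atanN.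
move: (atan (be / al * _)) (atan _) k0 => u v v0.
by field; rewrite gt_eqF.
Qed.

(** Let [tau] be the argument of [atan] in [angE]. Replacing [atan tau] by [tau] costs O(x^-2) after
    the rescaling, and dropping the shift [M] of the denominator costs O(x^-1); [M] is at most half
    of [s * x] in absolute value. *)
Lemma ang_asymp x y : 1 <= x -> 0 < y -> 2 * t * y <= s * x ->
  `|ang s t al be x y * x / (ang_cst * y) - 1| <=
    (8 * (2 * al * be * t * y) ^+ 2 / s ^+ 2 + 2 * t * y / s) / x.
Proof.
move=> x1 y0 xy; have k0 := atan_ratio_gt0 al0 be0.
have x0 : 0 < x by lra.
have sx0 : 0 < s * x by rewrite mulr_gt0.
have ty0 : 0 < t * y by rewrite mulr_gt0.
rewrite angE//; set T := 2 * al * be * t * y; set M := (_ - _) * (t * y).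
have T0 : 0 < T by rewrite !mulr_gt0.
have MM : `|M| <= t * y.
  rewrite /M normrM (gtr0_norm ty0) ler_piMl ?(ltW ty0)// ler_norml.
  by have := sqr_ge0 al; have := sqr_ge0 be; rewrite -albe; lra.
have D2 : s * x / 2 <= s * x + M.
  by move: MM xy; rewrite ler_norml -mulrA => /andP[]; lra.
have D0 : 0 < s * x + M by apply: lt_le_trans D2; rewrite divr_gt0.
set tau := T / _.
have tau0 : 0 <= tau by rewrite divr_ge0 ?ltW.
have tau2 : tau <= 2 * T / (s * x).
  rewrite ler_pdivrMr// mulrAC ler_pdivlMr//.
  have : T * (s * x / 2) <= T * (s * x + M) by rewrite ler_pM2l.
  lra.
have := atan_cubic tau; rewrite (ger0_norm tau0) => at3.
rewrite (_ : _ - 1 = (atan tau - tau) * (s * x / T) - M / (s * x + M)); last first.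
  rewrite /tau /ang_cst /T; field.
  rewrite !gt_eqF//.
apply: (le_trans (ler_normB _ _)); rewrite [leRHS]mulrDl; apply: lerD.
  rewrite normrM (ger0_norm (_ : 0 <= s * x / T)); last by rewrite divr_ge0 ?ltW.
  apply: (@le_trans _ _ ((2 * T / (s * x)) ^+ 3 * (s * x / T))).
    rewrite ler_wpM2r ?divr_ge0 ?(ltW sx0) ?(ltW T0)//.
    by apply: (le_trans at3); rewrite lerXn2r ?nnegrE// (le_trans tau0).
  rewrite (_ : _ * _ = 8 * T ^+ 2 / s ^+ 2 / x * x^-1); last by field; rewrite !gt_eqF.
  (* The bound of order x^-2 is weakened to x^-1, using [1 <= x]. *)
  rewrite ler_piMr ?invf_le1// !mulr_ge0 ?exprn_ge0 ?invr_ge0 ?exprn_ge0//; exact: ltW.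
rewrite normrM normfV (gtr0_norm D0) ler_pdivrMr//.
apply: (le_trans MM).
have : 2 * (t * y) / (s * x) * (s * x / 2) <= 2 * (t * y) / (s * x) * (s * x + M).
  by rewrite ler_wpM2l// divr_ge0 ?(ltW sx0)// mulr_ge0 ?(ltW ty0).
rewrite (_ : 2 * (t * y) / (s * x) * (s * x / 2) = t * y); last by field; rewrite !gt_eqF.
by rewrite (_ : 2 * t * y / s / x = 2 * (t * y) / (s * x))//; field; rewrite !gt_eqF.
Qed.

End asymptotics.

Lemma cvg_bound_inv (R : realType) (g : nat -> R) (l C : R) (N : nat) :
  (forall n : nat, (0 < n)%N -> (N <= n)%N -> `|g n - l| <= C / n%:R) -> g @ \oo --> l.
Proof.
move=> gC; apply/cvgrPdist_le => e e0.
exists (N + Num.bound (`|C| / e)).+1%N => // n /= nN.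
have n0 : (0 < n)%N by apply: leq_trans nN.
have n0R : 0 < n%:R :> R by rewrite ltr0n.
rewrite distrC; apply: (le_trans (gC n n0 _)).
  by apply: leq_trans (ltnW nN); rewrite leq_addr.
rewrite ler_pdivrMr// mulrC -ler_pdivrMr//.
apply: (@le_trans _ _ (`|C| / e)); first by rewrite ler_pM2r ?invr_gt0// ler_norm.
have : 0 <= `|C| / e by rewrite divr_ge0// ltW.
move=> /archi_boundP/ltW/le_trans; apply.
by rewrite ler_nat; apply: leq_trans (ltnW nN); rewrite leq_addl.
Qed.

(** * Nondegeneracy of the covariance *)

Section moments.
Variables (R : realType) (p : int -> int -> R).
Hypothesis law : is_law p.

Lemma Ex_ge_term (F : int -> int -> R) k l : (forall k l, 0 <= F k l) ->
  k \in dirs -> l \in dirs -> p k l * F k l <= Ex p F.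
Proof.
case: law => p0 _ F0 kd ld.
rewrite /Ex; move: dirs p0 kd ld => D p0 kd ld.
rewrite (big_rem k)//= (big_rem l)//= -addrA lerDl addr_ge0//.
  rewrite big_seq sumr_ge0// => j /mem_rem jd; exact: mulr_ge0 (p0 _ _ kd jd) (F0 _ _).
rewrite big_seq sumr_ge0// => i /mem_rem id; rewrite big_seq sumr_ge0// => j jd.
exact: mulr_ge0 (p0 _ _ id jd) (F0 _ _).
Qed.

Lemma Ex_le0 (F : int -> int -> R) k l : (forall k l, 0 <= F k l) -> Ex p F <= 0 ->
  k \in dirs -> l \in dirs -> F k l != 0 -> p k l = 0.
Proof.
move=> F0 EF kd ld Fkl; have := le_trans (Ex_ge_term F0 kd ld) EF.
case: law => p0 _; rewrite pmulr_lle0 ?lt_def ?Fkl ?F0// => pkl.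
by apply/eqP; rewrite eq_le pkl p0.
Qed.

Let a := Ex p (fun k _ => k%:~R ^+ 2).
Let b := Ex p (fun k l => k%:~R * l%:~R).
Let c := Ex p (fun _ l => l%:~R ^+ 2).

(** Steps confined to a line through the origin would leave three consecutive directions on one side
    of it without mass, against [H2]. *)
Lemma cov_nondegenerate : H2 p -> 0 < c /\ b ^+ 2 < a * c.
Proof.
move=> h2.
have c0 : 0 < c.
  rewrite ltNge; apply/negP => c0.
  have Z k l := @Ex_le0 (fun _ l => l%:~R ^+ 2) k l (fun _ l => sqr_ge0 _) c0.
  (* Entries 6, 7 and 0 of the cyclic list: the jumps with l = 1. *)
  apply: (h2 6%N isT); rewrite /=.
  by split; apply: Z => //; rewrite expf_neq0.
split=> //; rewrite ltNge; apply/negP => abc.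
(* Equality in Cauchy-Schwarz would confine the steps to a line. *)
have E : Ex p (fun k l => (c * k%:~R - b * l%:~R) ^+ 2) <= 0.
  rewrite (@eq_Ex _ _ _ (fun k l => c ^+ 2 * k%:~R ^+ 2 + (- (2 * b * c)) * (k%:~R * l%:~R)
    + b ^+ 2 * l%:~R ^+ 2)); last by move=> k l _ _; ring.
  rewrite !ExD !ExZ -/a -/b -/c.
  rewrite (_ : _ + _ = c * (a * c - b ^+ 2)); last by ring.
  by rewrite pmulr_rle0// subr_le0.
have Z k l := @Ex_le0 (fun k l => (c * k%:~R - b * l%:~R) ^+ 2) k l (fun _ _ => sqr_ge0 _) E.
have Zk k l : k \in dirs -> l \in dirs -> c * k%:~R - b * l%:~R != 0 -> p k l = 0.
  by move=> kd ld h; apply: Z => //; rewrite expf_neq0.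
have p10 : p 1 0 = 0 by apply: Zk => //; rewrite mulr1 mulr0 subr0 gt_eqF.
(* The line is c k = b l. It is vertical if [b = 0]; otherwise it misses both vertical directions
   and (1, 0), and also one of (1, 1) and (1, -1), which completes a run of three. *)
have [b0|bN0] := eqVneq b 0.
  have d l : l \in dirs -> p 1 l = 0.
    by move=> ld; apply: Zk => //; rewrite b0 mul0r subr0 mulr1 gt_eqF.
  by apply: (h2 0%N isT); split; rewrite /= d.
have p01 : p 0 1 = 0 by apply: Zk => //; rewrite mulr0 sub0r mulr1 oppr_eq0.
have p0m : p 0 (-1) = 0 by apply: Zk => //; rewrite mulr0 sub0r mulrN1 opprK.
have [cb|cb] := eqVneq c b; last first.
  apply: (h2 7%N isT); split => //=.
  by apply: Zk => //; rewrite !mulr1 subr_eq0.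
apply: (h2 1%N isT); split => //=.
by apply: Zk => //; rewrite mulr1 mulrN1 opprK -cb gt_eqF// addr_gt0.
Qed.

End moments.

(** * Choice of the coordinates and passage to the limit *)

Theorem theorem1 (R : realType) (p : int -> int -> R) :
  (forall k l, k \in dirs -> l \in dirs -> 0 <= p k l) ->
  \sum_(k <- dirs) \sum_(l <- dirs) p k l = 1 ->
  H2 p ->
  p 1 1 + p (-1) 1 + p (-1) (-1) + p 1 (-1) < 1 ->
  \sum_(k <- dirs) \sum_(l <- dirs) k%:~R * p k l = 0 ->
  \sum_(k <- dirs) \sum_(l <- dirs) l%:~R * p k l = 0 ->
  exists A : R, 0 < A /\
    forall j0 : nat, (1 <= j0)%N ->
      (fun i0 : nat => hitP p i0%:Z j0%:Z / (A * j0%:R / i0%:R)) @ \oo --> (1 : R).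
Proof.
move=> p0 p1 h2 _ Ek0 El0.
have law : is_law p by [].
have Ek : Ex p (fun k _ => k%:~R) = 0.
  by rewrite -Ek0; apply: eq_bigr => k _; apply: eq_bigr => l _; rewrite mulrC.
have El : Ex p (fun _ l => l%:~R) = 0.
  by rewrite -El0; apply: eq_bigr => k _; apply: eq_bigr => l _; rewrite mulrC.
have [c0 abc] := cov_nondegenerate law h2.
set a := Ex p (fun k _ => k%:~R ^+ 2) in abc.
set b := Ex p (fun k l => k%:~R * l%:~R) in abc.
set c := Ex p (fun _ l => l%:~R ^+ 2) in c0 abc.
have a0 : 0 < a.
  by rewrite -(pmulr_lgt0 _ c0); apply: le_lt_trans abc; exact: sqr_ge0.
pose s := Num.sqrt c; pose t := Num.sqrt a.
have s0 : 0 < s by rewrite sqrtr_gt0.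
have t0 : 0 < t by rewrite sqrtr_gt0.
have s2 : s ^+ 2 = c by rewrite sqr_sqrtr// ltW.
have t2 : t ^+ 2 = a by rewrite sqr_sqrtr// ltW.
have st0 : 0 < s * t by rewrite mulr_gt0.
have bst : `|b| < s * t.
  by rewrite -ltr_sqr ?nnegrE ?(ltW st0)// -normrX ger0_norm ?sqr_ge0// exprMn s2 t2 mulrC.
have [bl br] : - (s * t) < b /\ b < s * t by move: bst; rewrite ltr_norml => /andP.
have al20 : 0 < (s * t - b) / (2 * (s * t)) by rewrite divr_gt0 ?mulr_gt0// subr_gt0.
have be20 : 0 < (s * t + b) / (2 * (s * t)).
  by rewrite divr_gt0 ?mulr_gt0// -[b]opprK subr_gt0 ltrNl.
(* These solve al^2 + be^2 = 1 and s t (be^2 - al^2) = b; both are positive because |b| < s t. *)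
pose al := Num.sqrt ((s * t - b) / (2 * (s * t))).
pose be := Num.sqrt ((s * t + b) / (2 * (s * t))).
have al0 : 0 < al by rewrite sqrtr_gt0.
have be0 : 0 < be by rewrite sqrtr_gt0.
have al2 : al ^+ 2 = (s * t - b) / (2 * (s * t)) by rewrite sqr_sqrtr// ltW.
have be2 : be ^+ 2 = (s * t + b) / (2 * (s * t)) by rewrite sqr_sqrtr// ltW.
have albe : al ^+ 2 + be ^+ 2 = 1 by rewrite al2 be2; field; rewrite !gt_eqF.
have Ekl : Ex p (fun k l => k%:~R * l%:~R) = s * t * (be ^+ 2 - al ^+ 2).
  by rewrite al2 be2 -/b; field; rewrite !gt_eqF.
have hA := hitP_ang s0 t0 al0 be0 albe law Ek El (esym t2) (esym s2) Ekl.
have K0 := bar_cst_gt0 s0 t0 al0 be0.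
set K := bar_cst s t al be in hA K0.
pose A := ang_cst s t al be.
have A0 : 0 < A by exact: ang_cst_gt0.
exists A; split=> // j j1.
have j0 : 0 < j%:R :> R by rewrite ltr0n.
set y : R := j%:R in j0 *.
(* [C1] comes from the barrier through [bar_le], with [t * y] dropped from the denominator, and [C2]
   from [ang_asymp]. The threshold on [n] below ensures [2 * t * y <= s * x]. *)
pose C1 := K * (4 * s * t * be ^+ 2 / al ^+ 2) / (s ^+ 3 * A).
pose C2 := 8 * (2 * al * be * t * y) ^+ 2 / s ^+ 2 + 2 * t * y / s.
apply: (@cvg_bound_inv _ _ _ (C1 + C2) (Num.bound (2 * t * y / s))) => n n0 nN.
have x1 : 1 <= n%:R :> R by rewrite ler1n.
set x : R := n%:R in x1 *.
have x0 : 0 < x by lra.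
have xy : 2 * t * y <= s * x.
  rewrite [s * x]mulrC -ler_pdivrMr//.
  have : 0 <= 2 * t * y / s by rewrite !mulr_ge0 ?invr_ge0//; exact: ltW.
  by move=> /archi_boundP/ltW/le_trans; apply; rewrite ler_nat.
have := hA n%:Z j%:Z n0 j1; rewrite -!pmulrn -/x -/y => h1.
have h3 := ang_asymp s0 t0 al0 be0 albe x1 j0 xy.
have xA0 : 0 < x / (A * y) by rewrite divr_gt0// mulr_gt0.
rewrite (_ : _ - 1 = (hitP p n%:Z j%:Z - ang s t al be x y) * (x / (A * y))
   + (ang s t al be x y * x / (A * y) - 1)); last first.
  by field; rewrite !gt_eqF.
rewrite [leRHS]mulrDl; apply: (le_trans (ler_normD _ _)); apply: lerD; last exact: h3.
rewrite normrM (gtr0_norm xA0).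
have bl' := bar_le s0 t0 al0 be0 albe (ltW x0) (ltW j0) (addr_gt0 x0 j0).
have sx0 : 0 < s * x by rewrite mulr_gt0.
have ty0 : 0 < t * y by rewrite mulr_gt0.
have bb : bar s t al be x y <= 4 * s * t * be ^+ 2 / al ^+ 2 * (x * y) / (s * x) ^+ 3.
  apply: (le_trans bl'); rewrite ler_wpM2l//.
    by rewrite !mulr_ge0 ?exprn_ge0 ?invr_ge0 ?exprn_ge0//; exact: ltW.
  rewrite lef_pV2 ?posrE ?exprn_gt0 ?addr_gt0//.
  by rewrite lerXn2r ?nnegrE ?addr_ge0 ?(ltW sx0) ?(ltW ty0)// lerDl ltW.
apply: (@le_trans _ _ (K * (4 * s * t * be ^+ 2 / al ^+ 2 * (x * y) / (s * x) ^+ 3) * (x / (A * y)))).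
  by rewrite ler_pM2r//; apply: (le_trans h1); rewrite ler_pM2l.
rewrite le_eqVlt; apply/orP; left; apply/eqP.
by rewrite /C1; field; rewrite !gt_eqF.
Qed.
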